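(* Let $1\le k\le n-1$ and let $$p(q)=(-1)^{k(n-k)}\sum_{w\in S_n^{(k)}}(-1)^{\ell(w)}q^{\eta(w)}\in\mathbb{Z}[q].$$ Then, for nonnegative integers $j,m$: (i) if $(k,n)$ equals $(2j,2m)$, $(2j,2m+1)$ or $(2j+1,2m+1)$, then $$p(q)=\begin{bmatrix}m\\ j\end{bmatrix}_{q^2};$$ (ii) if $(k,n)=(2j+1,2m)$, then $$p(q)=(q^m-1)\begin{bmatrix}m-1\\ j\end{bmatrix}_{q^2}.$$
   Context: $S_n$ is the symmetric group with length function $\ell$; $S_n^{(k)}$ is the set of minimal length coset representatives of $S_n/(S_k\times S_{n-k})$, i.e. the $w\in S_n$ with $w(1)<\cdots<w(k)$ and $w(k+1)<\cdots<w(n)$; for these $\ell(w)=\sum_{j=1}^k(w(j)-j)$. $Y_w$ is the Young diagram of left-justified boxes contained in the $k\times(n-k)$ rectangle having $w(j)-j$ boxes in the $j$-th row from the bottom, $j=1,\dots,k$. Fill the boxes of $Y_w$ with $q$ and $1$ in a checkerboard pattern with $q$ in the northwest corner box: the box in the $a$-th row from the top and $b$-th column contains $q$ if $a+b$ is even and $1$ if $a+b$ is odd. Then $\eta(w)$ is the number of $q$'s in $Y_w$. The Gaussian binomial is $\begin{bmatrix}n\\k\end{bmatrix}_q=\frac{[n]_q!}{[k]_q!\,[n-k]_q!}$ with $[k]_q!=[k]_q[k-1]_q\cdots[1]_q$, $[k]_q=1+q+\cdots+q^{k-1}$; the subscript $q^2$ means $q$ is replaced by $q^2$. *)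

(* Defs.v *)
From mathcomp Require Import all_boot all_order all_fingroup all_algebra.

Set Implicit Arguments.
Unset Strict Implicit.
Unset Printing Implicit Defensive.

Import GRing.Theory.

(* Permutations act on 'I_n = {0, .., n-1}, so all indices below are shifted
   by one with respect to {1, .., n}; differences w(j) - j are unaffected.    *)

Definition simple_transposition (n : nat) (s : 'S_n) : bool :=
  [exists i : 'I_n, exists j : 'I_n, (j == i.+1 :> nat) && (s == tperm i j)].

Definition has_word (n : nat) (w : 'S_n) (d : nat) : bool :=
  [exists t : d.-tuple 'S_n,
     all (@simple_transposition n) t && ((\prod_(s <- t) s)%g == w)].

Lemma has_wordP (n : nat) (w : 'S_n) (d : nat) :
  reflect (exists t : seq 'S_n, [/\ size t = d,
             all (@simple_transposition n) t & (\prod_(s <- t) s)%g = w])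
          (has_word w d).
Proof.
apply: (iffP existsP) => [[t /andP[ht /eqP hw]]|[t [/eqP hs ht hw]]].
  by exists t; rewrite size_tuple.
by exists (Tuple hs); rewrite /= ht hw eqxx.
Qed.

Lemma has_wordM (n : nat) (u v : 'S_n) (c d : nat) :
  has_word u c -> has_word v d -> has_word (u * v)%g (c + d).
Proof.
move=> /has_wordP[s [<- hs <-]] /has_wordP[t [<- ht <-]].
by apply/has_wordP; exists (s ++ t); rewrite size_cat all_cat hs ht big_cat.
Qed.

Lemma has_word_tperm (n : nat) (i j : 'I_n) :
  i < j -> exists d, has_word (tperm i j) d.
Proof.
move: {2}(j - i) (leqnn (j - i)) => m.
elim: m i j => [|m IH] i j; first by rewrite leqn0 subn_eq0 leqNgt => /negP.
move=> hm lt_ij.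
have lt_in : i.+1 < n by apply: leq_ltn_trans lt_ij (ltn_ord j).
pose k := Ordinal lt_in.
have hik : has_word (tperm i k) 1.
  apply/has_wordP; exists [:: tperm i k]; split=> //; last by rewrite big_seq1.
  by rewrite /= andbT; apply/existsP; exists i; apply/existsP; exists k; rewrite !eqxx.
case: (eqVneq k j) => [<-|neq_kj]; first by exists 1.
have lt_kj : k < j by rewrite ltn_neqAle lt_ij andbT.
have [|d hd] := IH k j _ lt_kj.
  by move: hm; rewrite !leq_subLR /= addSnnS.
exists (1 + d + 1).
have -> : tperm i j = (tperm i k * tperm k j * tperm i k)%g.
  have neq_ij : i != j by rewrite -val_eqE ltn_eqF.
  by have := tpermJ k j (tperm i k); rewrite tpermR tpermD // conjgE tpermV mulgA => ->.
by apply: has_wordM => //; apply: has_wordM.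
Qed.

Lemma ex_word (n : nat) (w : 'S_n) : exists d, has_word w d.
Proof.
have [ts -> hts] := prod_tpermP w.
elim: ts hts => [_|[i j] ts IH /= /andP[neq_ij /IH[d hd]]].
  by exists 0; apply/has_wordP; exists [::]; rewrite !big_nil.
rewrite big_cons.
have [c hc] : exists c, has_word (tperm i j) c.
  case: (ltngtP i j) => [/has_word_tperm // | lt_ji | /val_inj eq_ij].
    by rewrite tpermC; apply: has_word_tperm.
  by move: neq_ij; rewrite /= eq_ij eqxx.
by exists (c + d); apply: has_wordM.
Qed.

(* The Coxeter length function of S_n: the least number of factors in an
   expression as a product of simple transpositions.                          *)
Definition perm_length (n : nat) (w : 'S_n) : nat := ex_minn (ex_word w).

(* One-line notations increasing on the first k and on the last n - k positions. *)
Definition min_coset_reps (n k : nat) : {set 'S_n} :=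
  [set w : 'S_n | [forall i : 'I_n, forall j : 'I_n,
     [&& i < j & (j < k) || (k <= i)] ==> (w i < w j)]].

(* The box (a, b) is in row a from the top and column b, both counted from 0.
   Row a from the top is row i from the bottom when i + a = k - 1.            *)
Definition young_diagram (n k : nat) (w : 'S_n) : {set 'I_k * 'I_(n - k)} :=
  [set c : 'I_k * 'I_(n - k) | [exists i : 'I_n, ((i + c.1).+1 == k) && (c.2 < w i - i)]].

(* Shifting both coordinates by one preserves the parity of their sum. *)
Definition eta (n k : nat) (w : 'S_n) : nat :=
  #|[set c in young_diagram k w | ~~ odd (c.1 + c.2)]|.

Local Open Scope ring_scope.

Definition qint (F : fieldType) (q : F) (k : nat) : F := \sum_(i < k) q ^+ i.

Definition qfact (F : fieldType) (q : F) (k : nat) : F :=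
  \prod_(1 <= i < k.+1) qint q i.

Definition qbinom (F : fieldType) (q : F) (n k : nat) : F :=
  qfact q n / (qfact q k * qfact q (n - k)).

Definition p_poly (n k : nat) : {poly int} :=
  (-1) ^+ (k * (n - k)) *
  \sum_(w in min_coset_reps n k) (-1) ^+ perm_length w * 'X^(eta k w).

(* Main.v *)
(* Removing the value 0 from the one-line notation of w (it sits in position 0
   or k) deletes an empty last row of the Young diagram or a full first column;
   the latter exchanges the two colors.  Iterating this once more, the two mixed
   terms differ by a box of weight -1 when that box is colored 1, and cancel; what
   remains is the q^2-Pascal rule.  The parities of (k, n - k) not covered this
   way follow from one application of the single-step rule. *)

Require Import Defs.
From mathcomp Require Import all_boot all_order all_fingroup all_algebra.
From mathcomp Require Import zify ring.

Import GRing.Theory.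

(** * Parity of the length *)

Lemma odd_simple_transposition (n : nat) (s : 'S_n) :
  simple_transposition s -> odd_perm s.
Proof.
case/existsP=> i /existsP[j /andP[/eqP ij /eqP->]].
by rewrite odd_tperm -val_eqE /= ij neq_ltn ltnSn.
Qed.

(** Each simple transposition is odd, so any word, in particular a shortest one, has size of the
    parity of [w]. From here on the sign replaces the length. *)
Lemma odd_perm_length (n : nat) (w : 'S_n) : odd (perm_length w) = odd_perm w.
Proof.
rewrite /perm_length; case: ex_minnP => d /has_wordP[t [<- ht <-]] _.
elim: t ht => [_|s t IH /= /andP[hs /IH->]]; first by rewrite big_nil odd_perm1.
by rewrite big_cons odd_permM (odd_simple_transposition _ _ hs).
Qed.

(** * Coset representatives and deletion of the value 0 *)

Lemma lift_perm_surj (n : nat) (i j : 'I_n.+1) (w : 'S_n.+1) :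
  w i = j -> exists s, w = lift_perm i j s.
Proof.
(* The default [k] is never reached: [w (lift i k)] differs from [w i = j]. *)
move=> wij; pose f k := odflt k (unlift j (w (lift i k))).
have fK k : lift j (f k) = w (lift i k).
  rewrite /f; case: unliftP => //= /eqP; rewrite -wij (inj_eq perm_inj).
  by rewrite eq_sym (negPf (neq_lift i k)).
have f_inj : injective f.
  by move=> a b ab; apply/(@lift_inj _ i)/(@perm_inj _ w); rewrite -!fK ab.
exists (perm f_inj); apply/permP=> k.
case: (unliftP i k) => [k'|] ->; last by rewrite lift_perm_id.
by rewrite lift_perm_lift permE fK.
Qed.

Lemma lift_perm_inj (n : nat) (i j : 'I_n.+1) : injective (lift_perm i j).
Proof.
move=> s t st; apply/permP=> k; apply: (@lift_inj _ j).
by rewrite -!(lift_perm_lift i) st.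
Qed.

Lemma min_coset_repsP (n k : nat) (w : 'S_n) :
  reflect (forall i j : 'I_n, i < j -> (j < k) || (k <= i) -> w i < w j)
          (w \in min_coset_reps n k).
Proof.
rewrite inE; apply: (iffP forallP) => [h i j ij hk|h i].
  by move/forallP/(_ j)/implyP: (h i) => -> //; rewrite ij.
by apply/forallP=> j; apply/implyP=> /andP[]; apply: h.
Qed.

Lemma min_coset_reps_gap (n k : nat) (w : 'S_n) (i j : 'I_n) :
  w \in min_coset_reps n k -> i <= j -> j < k -> w i + (j - i) <= w j.
Proof.
move=> /min_coset_repsP hw; move: {2}(j - i) (erefl (j - i)) => d.
elim: d j => [|d IH] j dE ij jk.
  have -> : i = j by apply: val_inj => /=; lia.
  by rewrite subnn addn0.
have hj : j.-1 < n by have := ltn_ord j; lia.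
have := IH (Ordinal hj); rewrite /= => /(_ ltac:(lia) ltac:(lia) ltac:(lia)).
have := hw (Ordinal hj) j; rewrite /= => /(_ ltac:(lia)).
by rewrite jk => /(_ isT); lia.
Qed.

(** Compare position [i] with positions 0 and k - 1, whose values lie in [0, n - 1]. Hence the
    diagram fits in its rectangle and the subtractions [w i - i] do not truncate. *)
Lemma min_coset_reps_bound (n k : nat) (w : 'S_n) (i : 'I_n) :
  w \in min_coset_reps n k -> i < k -> k <= n -> i <= w i <= i + (n - k).
Proof.
move=> hw ik kn.
have h0 : 0 < n by lia.
have hl : k.-1 < n by lia.
have := min_coset_reps_gap n k w (Ordinal h0) i hw isT ik.
have := min_coset_reps_gap n k w i (Ordinal hl) hw; rewrite /=.
move=> /(_ ltac:(lia) ltac:(lia)).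
by have := ltn_ord (w (Ordinal hl)); lia.
Qed.

Lemma min_coset_reps_full (n : nat) : min_coset_reps n n = [set 1%g].
Proof.
apply/setP=> w; rewrite in_set1; apply/idP/eqP=> [hw|->].
  apply/permP=> i; apply/val_inj; rewrite perm1 /=.
  by have := min_coset_reps_bound n n w i hw (ltn_ord i) (leqnn n); lia.
by apply/min_coset_repsP=> i j; rewrite !perm1.
Qed.

Lemma min_coset_reps_empty (n : nat) : min_coset_reps n 0 = [set 1%g].
Proof.
(* For k = 0 and for k = n the condition is the same: [w] is increasing everywhere. *)
rewrite -min_coset_reps_full; apply/setP=> w.
by apply/min_coset_repsP/min_coset_repsP => h i j ij _; apply: h;
  rewrite ?ltn_ord ?orbT.
Qed.

Lemma min_coset_reps_lift0 (n k : nat) (s : 'S_n) :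
  (lift_perm ord0 ord0 s \in min_coset_reps n.+1 k.+1) =
  (s \in min_coset_reps n k).
Proof.
apply/min_coset_repsP/min_coset_repsP=> h i j.
  move=> ij hk; have := h (lift ord0 i) (lift ord0 j).
  by rewrite !lift_perm_lift !lift0 !ltnS; apply.
case: (unliftP ord0 j) => [j'|] -> //.
case: (unliftP ord0 i) => [i'|] ->; rewrite ?lift_perm_id !lift_perm_lift //.
by rewrite !lift0 !ltnS; apply: h.
Qed.

Lemma min_coset_reps_lift (n k : nat) (c : 'I_n.+1) (s : 'S_n) : c = k :> nat ->
  (lift_perm c ord0 s \in min_coset_reps n.+1 k) = (s \in min_coset_reps n k).
Proof.
move=> ck; apply/min_coset_repsP/min_coset_repsP=> h i j.
  move=> ij hk; have := h (lift c i) (lift c j).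
  rewrite !lift_perm_lift !lift0 !ltnS; apply; rewrite /= /bump; lia.
case: (unliftP c j) => [j'|] ->; last by lia.
case: (unliftP c i) => [i'|] ->; rewrite ?lift_perm_id !lift_perm_lift //.
by rewrite !lift0 !ltnS /= /bump => ij hk; apply: h; lia.
Qed.

(** Both blocks are increasing, so the least value can only open one of them, at position 0 or k. *)
Lemma min_coset_reps_preim0 (n k : nat) (c : 'I_n.+1) (w : 'S_n.+1) :
  c = k :> nat -> w \in min_coset_reps n.+1 k -> w ord0 != ord0 -> w c = ord0.
Proof.
move=> ck /min_coset_repsP hw w0.
have wj : w (w^-1%g ord0) = ord0 by rewrite permKV.
move: (w^-1%g ord0) wj => j wj.
have j0 : j != 0 :> nat.
  by apply: contra w0 => /eqP j0; apply/eqP; rewrite -[RHS]wj; congr (w _); apply: val_inj.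
case: (ltngtP j c) => jc; last by rewrite -wj; congr (w _); apply: val_inj.
  by have := hw ord0 j; rewrite wj lt0n => /(_ j0); rewrite -ck jc => /(_ isT).
by have := hw c j jc; rewrite wj ck leqnn orbT => /(_ isT).
Qed.

(** * Counting boxes of one color *)

(* Boxes in row a (from the top) and column b with odd (a + b) = c; the sum runs
   over i = k - 1 - a, the row counted from the bottom. *)
Definition colored_boxes (c : bool) (n k : nat) (w : 'S_n) : nat :=
  \sum_(i < n | i < k) \sum_(b < w i - i) (odd (k - i.+1 + b) == c).
Arguments colored_boxes c {n} k w.

Lemma colored_boxes1 (c : bool) (n k : nat) :
  colored_boxes c k (1%g : 'S_n) = 0.
Proof. by apply: big1 => i _; rewrite perm1 subnn big_ord0. Qed.

Lemma eta_colored (n k : nat) (w : 'S_n) :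
  k <= n -> w \in min_coset_reps n k -> eta k w = colored_boxes false k w.
Proof.
move=> kn hw.
pose F (a : 'I_k) (b : 'I_(n - k)) : nat :=
  (a, b) \in [set c in young_diagram k w | ~~ odd (c.1 + c.2)].
transitivity (\sum_a \sum_b F a b).
  rewrite /eta pair_bigA -sum1_card big_mkcond /=.
  by apply: eq_bigr => -[a b] _; rewrite /F; case: (_ \in _).
rewrite /colored_boxes (big_ord_narrow kn) [RHS](reindex_inj rev_ord_inj) /=.
apply: eq_bigr => a _; pose i := widen_ord kn (rev_ord a).
have ik : i < k by rewrite /= ltn_subrL; have := ltn_ord a; lia.
have hi := min_coset_reps_bound n k w i hw ik kn.
(* Rows have at most n - k boxes, so the column index can run over the whole rectangle. *)
rewrite (big_ord_widen (n - k)
  (fun b => nat_of_bool (odd (k - (k - a.+1).+1 + b) == false))).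
  rewrite [RHS]big_mkcond; apply: eq_bigr => b _; rewrite /F !inE /=.
  have -> : k - (k - a.+1).+1 = a by have := ltn_ord a; lia.
  have -> : [exists i0 : 'I_n, ((i0 + a).+1 == k) && (b < w i0 - i0)] =
            (b < w i - (k - a.+1)).
    apply/existsP/idP=> [[i' /andP[/eqP i'k]]|hb].
      have -> // : i' = i by apply: val_inj => /=; lia.
    by exists i; rewrite hb andbT /=; apply/eqP; have := ltn_ord a; lia.
  by case: ltnP => //= _; case: odd.
by rewrite /i /= in hi *; lia.
Qed.

(** The deleted row is the empty bottom one, so the other rows keep their index from the top and
    their colors. *)
Lemma colored_boxes_lift0 (c : bool) (n k : nat) (s : 'S_n) :
  colored_boxes c k.+1 (lift_perm ord0 ord0 s) = colored_boxes c k s.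
Proof.
rewrite /colored_boxes big_mkcond big_ord_recl lift_perm_id subnn big_ord0 /=.
rewrite add0n [RHS]big_mkcond; apply: eq_bigr => i _.
by rewrite lift_perm_lift !lift0 !subSS ltnS.
Qed.

Lemma count_parity (c : bool) (k : nat) :
  \sum_(a < k) (odd a == c) = (k + ~~ c)./2.
Proof.
elim: k => [|k IH]; first by rewrite big_ord0; case: c.
by rewrite big_ord_recr IH; case: c {IH} => /=; case: (boolP (odd k)) => /= hk; lia.
Qed.

(** The first [k] values drop by one, which removes a full first column of height [k]. The remaining
    boxes move one step left and change color. *)
Lemma colored_boxes_lift (c : bool) (n k : nat) (p : 'I_n.+1) (s : 'S_n) :
  p = k :> nat -> s \in min_coset_reps n k ->
  colored_boxes c k (lift_perm p ord0 s) =
  (k + ~~ c)./2 + colored_boxes (~~ c) k s.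
Proof.
move=> pk hs; have kn : k <= n by rewrite -pk -ltnS.
rewrite /colored_boxes big_mkcond (bigD1_ord p) //= pk ltnn add0n.
transitivity (\sum_(i < n | i < k) ((odd (k - i.+1) == c) +
   \sum_(b < s i - i) (odd (k - i.+1 + b) == ~~ c))).
  rewrite [RHS]big_mkcond; apply: eq_bigr => i _; rewrite /bump.
  case: (leqP k i) => ik; first by rewrite add1n ltnNge (leq_trans ik).
  rewrite add0n ik lift_perm_lift lift0.
  have hi := min_coset_reps_bound n k s i hs ik kn.
  rewrite subSn; last by lia.
  rewrite big_ord_recl addn0; congr (_ + _); apply: eq_bigr => b _.
  by rewrite lift0 addnS oddS; case: odd c => [] [].
rewrite big_split /=; congr (_ + _).
rewrite (big_ord_narrow kn) (reindex_inj rev_ord_inj) /= -count_parity.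
by apply: eq_bigr => i _; congr (nat_of_bool (odd _ == _)); have := ltn_ord i; lia.
Qed.

Local Open Scope ring_scope.

(** * Signed sums over diagrams in a rectangle and their recurrences *)

Definition signed_sum (c : bool) (n k : nat) : {poly int} :=
  \sum_(w in min_coset_reps n k) (-1) ^+ (w : bool) * 'X^(colored_boxes c k w).

Lemma signed_sum0 c n : signed_sum c n 0 = 1.
Proof.
by rewrite /signed_sum min_coset_reps_empty big_set1 odd_perm1 colored_boxes1 mul1r.
Qed.

Lemma signed_sum_full c n : signed_sum c n n = 1.
Proof.
by rewrite /signed_sum min_coset_reps_full big_set1 odd_perm1 colored_boxes1 mul1r.
Qed.

Lemma signed_sumS c n k : (k < n)%N ->
  signed_sum c n.+1 k.+1 = signed_sum c n k +
    (-1) ^+ k.+1 * 'X^((k.+1 + ~~ c)./2) * signed_sum (~~ c) n k.+1.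
Proof.
move=> kn; have kn' : (k.+1 < n.+1)%N by [].
pose p := Ordinal kn'.
(* Split by whether 0 sits in position 0 or opens the second block, at [p]. *)
rewrite /signed_sum (bigID (fun w : 'S_n.+1 => w ord0 == ord0)) /=.
congr (_ + _).
  rewrite (eq_bigl (mem [set lift_perm ord0 ord0 s | s in min_coset_reps n k])).
    rewrite big_imset /=; last by move=> ? ? _ _; apply: lift_perm_inj.
    by apply: eq_bigr => s _; rewrite odd_lift_perm colored_boxes_lift0.
  move=> w; apply/andP/imsetP=> [[hw /eqP/lift_perm_surj[s ws]]|[s hs ->]].
    by exists s; rewrite // -min_coset_reps_lift0 -ws.
  by rewrite min_coset_reps_lift0 lift_perm_id.
rewrite (eq_bigl (mem [set lift_perm p ord0 s | s in min_coset_reps n k.+1])).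
  rewrite big_imset /=; last by move=> ? ? _ _; apply: lift_perm_inj.
  rewrite mulr_sumr; apply: eq_bigr => s hs.
  rewrite odd_lift_perm (colored_boxes_lift _ _ k.+1) //= addbF signr_addb.
  by rewrite -[~~ odd k]/(odd k.+1) signr_odd exprD mulrACA.
move=> w; apply/andP/imsetP=> [[hw w0]|[s hs ->]].
  have /lift_perm_surj[s ws] := min_coset_reps_preim0 _ _ p _ erefl hw w0.
  by exists s; rewrite // -(min_coset_reps_lift n k.+1 p) // -ws.
rewrite min_coset_reps_lift //; split=> //.
have -> : ord0 = lift p (Ordinal (leq_ltn_trans (leq0n k) kn)) by apply: val_inj.
by rewrite lift_perm_lift.
Qed.

Definition rect_sum (c : bool) (k l : nat) : {poly int} := signed_sum c (k + l) k.

Lemma rect_sum0l c l : rect_sum c 0 l = 1.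
Proof. exact: signed_sum0. Qed.

Lemma rect_sum0r c k : rect_sum c k 0 = 1.
Proof. by rewrite /rect_sum addn0 signed_sum_full. Qed.

Lemma rect_sumSS c k l :
  rect_sum c k.+1 l.+1 = rect_sum c k l.+1 +
    (-1) ^+ k.+1 * 'X^((k.+1 + ~~ c)./2) * rect_sum (~~ c) k.+1 l.
Proof.
rewrite /rect_sum addSn signed_sumS; last by rewrite addnS ltnS leq_addr.
by rewrite addnS addSn.
Qed.

(* The hypothesis says that box (k + 1, 0) does not carry q, so that a full first
   column weighs the same up to sign in heights k + 1 and k + 2. *)
Lemma rect_sum_cancel c k l : odd k = c ->
  rect_sum c k.+2 l.+1 = rect_sum c k l.+1 +
    (-1) ^+ k * 'X^((k.+2 + ~~ c)./2) *
      (rect_sum (~~ c) k.+2 l - rect_sum (~~ c) k.+1 l).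
Proof.
move=> kc; rewrite 2!rect_sumSS.
have -> : (k.+2 + ~~ c)./2 = (k.+1 + ~~ c)./2.
  by rewrite -kc; case: (boolP (odd k)) => /= hk; lia.
by move: 'X^_ => x; rewrite !exprS; ring.
Qed.

(** Expanding the first mixed term once more cancels the second. What is left has lost two full
    columns of height k + 2: their signs cancel, and each row loses exactly one colored box, whence
    'X^(k+2). *)
Lemma rect_sum_two_step c k l : odd k = c ->
  rect_sum c k.+2 l.+2 = rect_sum c k l.+2 + 'X^(k.+2) * rect_sum c k.+2 l.
Proof.
move=> kc; rewrite rect_sum_cancel // [rect_sum (~~ c) _ _]rect_sumSS negbK.
rewrite addrAC subrr add0r mulrA; congr (_ + _ * _).
rewrite mulrACA -exprD -signr_odd oddD /= negbK addbb mul1r -exprD.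
by congr ('X^ _); rewrite -kc; case: (boolP (odd k)) => /= hk; lia.
Qed.

Lemma rect_sum_column c k : odd k = c -> rect_sum c k.+2 1 = rect_sum c k 1.
Proof. by move=> kc; rewrite rect_sum_cancel // !rect_sum0r subrr mulr0 addr0. Qed.

(** With [c = true], [rect_sum_two_step] relates only odd heights, so induction starts from one row.
    There the empty and one-box diagrams cancel, and every longer row loses its first two boxes, of
    total weight 'X. *)
Lemma rect_sum_row l : rect_sum true 1 l.+2 = 'X * rect_sum true 1 l.
Proof. by rewrite !rect_sumSS !rect_sum0l /= expr0 expr1; ring. Qed.

Lemma rect_sum_box : rect_sum true 1 1 = 0.
Proof. by rewrite rect_sumSS rect_sum0l rect_sum0r /= expr0 expr1; ring. Qed.

(** * Gaussian binomials in a field *)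

Lemma qint_add (F : fieldType) (q : F) a b :
  qint q (a + b) = qint q a + q ^+ a * qint q b.
Proof.
rewrite /qint big_split_ord /= mulr_sumr; congr (_ + _).
by apply: eq_bigr => i _; rewrite exprD.
Qed.

Lemma qfactS (F : fieldType) (q : F) a : qfact q a.+1 = qfact q a * qint q a.+1.
Proof. by rewrite /qfact big_nat_recr. Qed.

Lemma qfact0 (F : fieldType) (q : F) : qfact q 0 = 1.
Proof. by rewrite /qfact big_geq. Qed.

Lemma qfact_neq0 (F : fieldType) (q : F) a :
  (forall i, qint q i.+1 != 0) -> qfact q a != 0.
Proof.
move=> q0; elim: a => [|a IH]; first by rewrite qfact0 oner_neq0.
by rewrite qfactS mulf_neq0.
Qed.

Lemma qbinom0 (F : fieldType) (q : F) n :
  (forall i, qint q i.+1 != 0) -> qbinom q n 0 = 1.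
Proof. by move=> q0; rewrite /qbinom subn0 qfact0 mul1r divff ?qfact_neq0. Qed.

Lemma qbinom_diag (F : fieldType) (q : F) n :
  (forall i, qint q i.+1 != 0) -> qbinom q n n = 1.
Proof. by move=> q0; rewrite /qbinom subnn qfact0 mulr1 divff ?qfact_neq0. Qed.

Lemma qbinom_pascal (F : fieldType) (q : F) a b :
  (forall i, qint q i.+1 != 0) ->
  qbinom q (a.+1 + b.+1) a.+1 =
  qbinom q (a + b.+1) a + q ^+ a.+1 * qbinom q (a.+1 + b) a.+1.
Proof.
move=> q0; rewrite /qbinom !addKn [(a.+1 + b)%N]addSnnS [(a.+1 + b.+1)%N]addSn.
(* Over a common denominator, Pascal's rule reduces to [a+b+2] = [a+1] + q^(a+1) [b+1]. *)
rewrite (qfactS _ q (a + b.+1)) -[(a + b.+1).+1]addSn qint_add !(qfactS _ q _).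
have := qfact_neq0 _ q a q0; have := qfact_neq0 _ q b q0.
move: (q0 a) (q0 b) (qfact q (a + b.+1)) (q ^+ a.+1).
move: (qint q a.+1) (qint q b.+1) (qfact q a) (qfact q b).
by move=> x y u v x0 y0 N z v0 u0; field; apply/and4P; split.
Qed.

(** * Evaluation according to the parities of the sides *)

Local Notation q2 := (tofrac ('X^2 : {poly int})).

Lemma qint_X2_neq0 i : qint q2 i.+1 != 0.
Proof.
have -> : qint q2 i.+1 = tofrac (\sum_(j < i.+1) ('X^2 : {poly int}) ^+ j).
  by rewrite rmorph_sum; apply: eq_bigr => j _; rewrite [RHS]tofracXn.
(* Evaluating at q = 1 gives i + 1, which is nonzero. *)
rewrite tofrac_eq0; apply/eqP => /(congr1 (horner^~ 1)).
rewrite horner_sum horner0 (eq_bigr (fun=> 1)) => [|j _].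
  by rewrite sumr_const card_ord => /eqP; rewrite Num.Theory.pnatr_eq0.
by rewrite !hornerE !expr1n.
Qed.

(** The recurrence advances the width by two, so [e] only selects the starting width, 0 or 1. *)
Lemma rect_sum_even a b (e : bool) :
  tofrac (rect_sum false a.*2 (e + b.*2)) = qbinom q2 (a + b) a.
Proof.
have q0 := qint_X2_neq0.
elim: a b => [|a IHa] b; first by rewrite rect_sum0l tofrac1 qbinom0.
elim: b => [|b IHb].
  rewrite !addn0 doubleS qbinom_diag //.
  case: e IHa => IHa; last by rewrite rect_sum0r tofrac1.
  rewrite rect_sum_column ?odd_double //.
  by have := IHa 0%N; rewrite !addn0 => ->; rewrite qbinom_diag.
rewrite qbinom_pascal // -IHa -IHb !doubleS !addnS.
rewrite rect_sum_two_step ?odd_double // tofracD tofracM -tofracXn -exprM.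
by rewrite mul2n doubleS.
Qed.

Lemma rect_sum_odd_even a b :
  tofrac (rect_sum true a.*2.+1 b.*2) = tofrac 'X^b * qbinom q2 (a + b) a.
Proof.
have q0 := qint_X2_neq0.
elim: a b => [|a IHa] b.
  rewrite qbinom0 // mulr1 double0; elim: b => [|b IHb].
    by rewrite rect_sum0r expr0.
  by rewrite doubleS rect_sum_row tofracM IHb -tofracM -exprS.
elim: b => [|b IHb].
  by rewrite rect_sum0r expr0 addn0 qbinom_diag // !tofrac1 mulr1.
rewrite !doubleS rect_sum_two_step /= ?odd_double // -!doubleS.
rewrite tofracD tofracM IHa IHb qbinom_pascal // -tofracXn -exprM mulrDr.
congr (_ + _); move: (qbinom _ _ _) => x; rewrite !mulrA -!tofracM -!exprD.
(* The exponents agree: (2a + 3) + b = (b + 1) + 2(a + 1). *)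
by congr (tofrac ('X^ _) * _); lia.
Qed.

(** The one-box rectangle gives 1 - 1, and the recurrences in steps of two carry this zero to all
    odd sides. *)
Lemma rect_sum_odd_odd a b : rect_sum true a.*2.+1 b.*2.+1 = 0.
Proof.
elim: a b => [|a IHa] b.
  elim: b => [|b IHb]; first exact: rect_sum_box.
  by rewrite doubleS rect_sum_row IHb mulr0.
elim: b => [|b IHb].
  by rewrite doubleS rect_sum_column /= ?odd_double // (IHa 0%N).
rewrite !doubleS rect_sum_two_step /= ?odd_double // -doubleS IHa.
by rewrite -doubleS IHb mulr0 addr0.
Qed.

(** The cancellation for [c = false] requires even height. At odd height a single step leads to sums
    already evaluated; the removed column of height 2a + 1 has a + 1 boxes colored q. *)
Lemma rect_sum_oddl a l :
  rect_sum false a.*2.+1 l.+1 =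
  rect_sum false a.*2 l.+1 - 'X^(a.+1) * rect_sum true a.*2.+1 l.
Proof.
rewrite rect_sumSS exprS -signr_odd odd_double mulr1 mulN1r mulNr.
by rewrite addn1 -doubleS doubleK.
Qed.

Lemma p_poly_rect_sum n k : (k <= n)%N ->
  p_poly n k = (-1) ^+ (k * (n - k)) * rect_sum false k (n - k).
Proof.
move=> kn; rewrite /p_poly /rect_sum subnKC //; congr (_ * _).
apply: eq_bigr => w hw; rewrite eta_colored //.
by rewrite -signr_odd odd_perm_length.
Qed.

(* The identities are stated in the fraction field of Z[q], where the Gaussian
   binomial is a quotient. *)
Theorem proposition4p1 (n k j m : nat) (hk : (1 <= k <= n - 1)%N) :
  ([\/ (k, n) = (2 * j, 2 * m)%N,
       (k, n) = (2 * j, 2 * m + 1)%N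
     | (k, n) = (2 * j + 1, 2 * m + 1)%N] ->
   tofrac (p_poly n k) = qbinom (tofrac ('X^2 : {poly int})) m j) /\
  ((k, n) = (2 * j + 1, 2 * m)%N ->
   tofrac (p_poly n k) =
     tofrac ('X^m - 1 : {poly int}) *
       qbinom (tofrac ('X^2 : {poly int})) (m - 1) j).
Proof.
have kn : (k <= n)%N by lia.
(* The global sign is -1 only when [k] and [n - k] are both odd, which is case (ii). *)
rewrite p_poly_rect_sum // -signr_odd oddM.
split=> [[] [kE nE]|[kE nE]].
- have [b mE] : exists b, m = (j + b)%N by exists (m - j)%N; lia.
  have -> : k = j.*2 by lia.
  have -> : (n - j.*2 = false + b.*2)%N by lia.
  by rewrite odd_double mul1r rect_sum_even mE.
- have [b mE] : exists b, m = (j + b)%N by exists (m - j)%N; lia.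
  have -> : k = j.*2 by lia.
  have -> : (n - j.*2 = true + b.*2)%N by lia.
  by rewrite odd_double mul1r rect_sum_even mE.
(* Since k < n, j < m; the width is thus positive, as [rect_sum_oddl] requires. *)
- have [b mE] : exists b, m = (j + b.+1)%N by exists (m - j).-1; lia.
  have -> : k = j.*2.+1 by lia.
  have -> : (n - j.*2.+1 = b.*2.+2)%N by lia.
  rewrite /= !odd_double mul1r rect_sum_oddl rect_sum_odd_odd mulr0 subr0.
  by rewrite -doubleS -[b.+1.*2]/(false + b.+1.*2)%N rect_sum_even mE.
- have [b mE] : exists b, m = (j + b).+1 by exists (m - j).-1; lia.
  have -> : k = j.*2.+1 by lia.
  have -> : (n - j.*2.+1 = b.*2.+1)%N by lia.
  rewrite /= !odd_double rect_sum_oddl expr1 mulN1r opprB tofracB tofracM.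
  rewrite rect_sum_odd_even -[b.*2.+1]/(true + b.*2)%N rect_sum_even mE.
  (* The column contributes 'X^(j+1) and [rect_sum_odd_even] contributes 'X^b; their product is
     'X^m. *)
  rewrite subn1 tofracB tofrac1 mulrBl mul1r mulrA -tofracM -exprD.
  by rewrite addSn.
Qed.
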